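(* Let $p>1$ be an integer and let $u^{(p)}$ be the infinite word over $\{L,S,M\}$ invariant under the substitution $\varphi_p$ defined by $\varphi_p(L)=L^pS$, $\varphi_p(S)=M$, $\varphi_p(M)=L^{p-1}S$. Then $u^{(p)}$ is $3$-balanced with respect to the letter $L$, $2$-balanced with respect to the letter $S$, and $2$-balanced with respect to the letter $M$, and none of these bounds can be improved (i.e. $u^{(p)}$ is not $2$-balanced with respect to $L$, not $1$-balanced with respect to $S$, and not $1$-balanced with respect to $M$).
   Context: The substitution $\varphi_p$ is extended to a morphism of the free monoid $\{L,S,M\}^*$ and to infinite words; its unique fixed point is $u^{(p)}=\lim_{n\to\infty}\varphi_p^n(L)$. A factor of an infinite word $u$ is a finite word $w$ such that $u=w^{(1)}ww^{(2)}$ for some finite word $w^{(1)}$ and infinite word $w^{(2)}$. For a finite word $w$, $|w|$ is its length and $|w|_a$ the number of occurrences of the letter $a$ in $w$. An infinite word $u$ is $c$-balanced with respect to the letter $a$ if $\left||v|_a-|w|_a\right|\le c$ for all pairs of factors $v,w$ of $u$ with $|v|=|w|$. *)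

(* Defs.v *)
From HB Require Import structures.
From mathcomp Require Import all_boot.
Set Implicit Arguments. Unset Strict Implicit. Unset Printing Implicit Defensive.

Inductive letter := L | S | M.

Definition letter_eqb (a b : letter) : bool :=
  match a, b with L, L | S, S | M, M => true | _, _ => false end.
Lemma letter_eqP : Equality.axiom letter_eqb.
Proof. by case; case; constructor. Qed.
HB.instance Definition _ := hasDecEq.Build letter letter_eqP.

Definition phi (p : nat) (a : letter) : seq letter :=
  match a with
  | L => nseq p L ++ [:: S]
  | S => [:: M]
  | M => nseq p.-1 L ++ [:: S]
  end.

Definition phi_word (p : nat) (w : seq letter) : seq letter :=
  flatten (map (phi p) w).

Definition phi_iter (p k : nat) : seq letter := iter k (phi_word p) [:: L].

(* The fixed point u^(p) = lim phi_p^n(L), as a function nat -> letter: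
   for p >= 1, phi_p^k(L) is a prefix of phi_p^(k+1)(L) and has length > k,
   so the n-th letter of the limit is the n-th letter of phi_p^(n+1)(L). *)
Definition u (p : nat) (n : nat) : letter := nth L (phi_iter p n.+1) n.

Definition factor (x : nat -> letter) (w : seq letter) : Prop :=
  exists i, w = [seq x (i + j) | j <- iota 0 (size w)].

Definition balanced (c : nat) (x : nat -> letter) (a : letter) : Prop :=
  forall v w : seq letter, factor x v -> factor x w -> size v = size w ->
    count_mem a v <= count_mem a w + c.

Example u2_prefix : [seq u 2 i | i <- iota 0 8] = [:: L; L; S; L; L; S; M; L].
Proof. by []. Qed.

(* Main.v *)
Require Import Defs.
From mathcomp Require Import all_boot all_order all_algebra.
From mathcomp Require Import zify ring lra realalg.
Set Implicit Arguments. Unset Strict Implicit. Unset Printing Implicit Defensive.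

(* Every position n of the fixed point lies in the image of the letter at a
   unique position m, its parent, and the letter counts of the prefix of length
   n are linear in those of the prefix of length m and the offset c of n in that
   image. If 1/t is the Perron root, so that p t = 1 - t^2 + t^3, the functional
   zeta = t (|.|_L + |.|_M) - |.|_S satisfies
     zeta n = t c - (t - t^2) zeta (parent n) + t zeta (parent (parent n)),
   so it is bounded on prefixes. Let l, s, m be the differences of the letter
   counts of two factors of equal length. The alternating sum over the four end
   points is - (1 + t) s for zeta, l for zeta + zeta_parent, and - (1 + t) m for
   t zeta + (1 + t) zeta_parent, so the ranges of these three functionals bound
   s, l and m; for p >= 4 this gives the claimed constants.
   For p = 2 and p = 3 the ranges are too large. Instead the four end points are
   replaced repeatedly by their parents, which leads to four copies of position
   0. The triple (l, s, m) and the four letters determine finitely many possible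
   successors, the bounds on zeta leave finitely many nodes, and no path from an
   unbalanced node reaches the triple (0, 0, 0).
   For the optimality, factors attaining the bounds are given by the digits of
   their end points in the numeration system of the substitution. *)

(** * Prefix counts and desubstitution *)

Section FixedPoint.
Variable p : nat.
Hypothesis p_gt1 : 1 < p.

Local Notation prefix_u n := (mkseq (u p) n).

Lemma phi_word_cat v w : phi_word p (v ++ w) = phi_word p v ++ phi_word p w.
Proof. by rewrite /phi_word map_cat flatten_cat. Qed.

Lemma size_phi_gt0 a : 0 < size (phi p a).
Proof. by case: a; rewrite //= size_cat /= addn1. Qed.

Lemma size_phi_word_ge w : size w <= size (phi_word p w).
Proof.
elim: w => //= a w IHw; rewrite /phi_word /= size_cat -add1n.
exact: leq_add (size_phi_gt0 a) IHw.
Qed.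

Lemma phi_iterS k : phi_iter p k.+1 = phi_word p (phi_iter p k).
Proof. by []. Qed.

Lemma prefix_phi_iterS k : prefix (phi_iter p k) (phi_iter p k.+1).
Proof.
elim: k => [|k /prefixP[w Ew]]; first last.
  by rewrite phi_iterS (phi_iterS k.+1) Ew phi_word_cat prefix_prefix.
by move: p_gt1; case: p => // q _; rewrite /phi_iter /= prefix0s.
Qed.

Lemma prefix_phi_iter j k : j <= k -> prefix (phi_iter p j) (phi_iter p k).
Proof.
move/subnK <-; elim: (k - j) => [|d IHd]; first exact: prefix_refl.
exact: prefix_trans IHd (prefix_phi_iterS _).
Qed.

Lemma size_phi_iter k : k < size (phi_iter p k).
Proof.
elim: k => // k IHk; have /prefixP[w Ew] := prefix_phi_iter (leq0n k).
rewrite phi_iterS Ew phi_word_cat size_cat.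
apply: (@leq_trans (2 + size w)).
  by move: IHk; rewrite Ew size_cat.
apply: leq_add (size_phi_word_ge w).
by rewrite /phi_iter /phi_word /= cats0 size_cat size_nseq addn1 ltnS ltnW.
Qed.

Lemma u_phi_iter k n : n < size (phi_iter p k) -> u p n = nth L (phi_iter p k) n.
Proof.
move=> n_lt; rewrite /u; have n_ltS := ltn_trans (ltnSn n) (size_phi_iter n.+1).
have [/prefix_phi_iter|/ltnW/prefix_phi_iter] := leqP k n.+1.
  by case/prefixP=> w ->; rewrite nth_cat n_lt.
by case/prefixP=> w ->; rewrite nth_cat n_ltS.
Qed.

Lemma prefix_u_phi_iter k n : n <= size (phi_iter p k) ->
  prefix_u n = take n (phi_iter p k).
Proof.
move=> n_le; apply: (@eq_from_nth _ L); first by rewrite size_mkseq size_takel.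
move=> i; rewrite size_mkseq => i_lt.
by rewrite nth_mkseq // nth_take // (@u_phi_iter k) // (leq_trans i_lt).
Qed.

(** This is the invariance of [u p] under the substitution, read off on finite prefixes from two
    consecutive iterates. *)
Lemma phi_word_prefix m :
  phi_word p (prefix_u m) = prefix_u (size (phi_word p (prefix_u m))).
Proof.
have m_le := ltnW (size_phi_iter m).
have Em := prefix_u_phi_iter m_le.
have Ecat : phi_iter p m.+1 =
    phi_word p (prefix_u m) ++ phi_word p (drop m (phi_iter p m)).
  by rewrite phi_iterS -{1}(cat_take_drop m (phi_iter p m)) phi_word_cat Em.
rewrite [RHS](@prefix_u_phi_iter m.+1) Ecat ?take_size_cat //.
by rewrite size_cat leq_addr.
Qed.

(** The parent of position n is the m with n = [image_start m] + c and c inside the image of the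
    letter at m. *)
Definition image_start m := size (phi_word p (prefix_u m)).

Lemma image_startS m : image_start m.+1 = image_start m + size (phi p (u p m)).
Proof.
by rewrite /image_start mkseqS -cats1 phi_word_cat size_cat /phi_word /= cats0.
Qed.

Lemma prefix_u_image m c : c <= size (phi p (u p m)) ->
  prefix_u (image_start m + c) = phi_word p (prefix_u m) ++ take c (phi p (u p m)).
Proof.
move=> c_le; have Em1 := phi_word_prefix m.+1.
rewrite -/(image_start _) image_startS mkseqS -cats1 phi_word_cat in Em1.
rewrite {2}/phi_word /= cats0 in Em1.
have := congr1 (take (image_start m + c)) Em1.
rewrite take_cat ltnNge leq_addr /= addKn => ->.
by rewrite /mkseq -map_take take_iota (minn_idPl _) // leq_add2l.
Qed.

Lemma u_image m c : c < size (phi p (u p m)) ->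
  u p (image_start m + c) = nth L (phi p (u p m)) c.
Proof.
move=> c_lt; have := prefix_u_image c_lt; rewrite addnS mkseqS.
rewrite (take_nth L) // -rcons_cat -prefix_u_image; last exact: ltnW.
by case/rcons_inj.
Qed.

Definition count_u a n := count_mem a (prefix_u n).

Lemma count_phi_word a w : count_mem a (phi_word p w) =
  count_mem L w * count_mem a (phi p L) + count_mem S w * count_mem a (phi p S)
  + count_mem M w * count_mem a (phi p M).
Proof.
elim: w => // b w IHw; rewrite /phi_word /= count_cat IHw.
by case: b; rewrite !add0n ?add1n ?mulSn /=; lia.
Qed.

(** Each image is a block of L followed by one letter, so an offset adds to the count of L only. *)
Lemma take_phi c a : c < size (phi p a) -> take c (phi p a) = nseq c L.
Proof.
have take_nseqL j k : c <= k -> take c (nseq k L ++ j) = nseq c L.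
  move=> c_le; rewrite takel_cat ?size_nseq //.
  by rewrite -(subnKC c_le) nseqD take_size_cat ?size_nseq.
by case: a => /=; rewrite ?size_cat ?size_nseq ?addn1 ?ltnS; [|case: c {take_nseqL}|];
   try exact: take_nseqL.
Qed.

Lemma count_u_image m c : c < size (phi p (u p m)) ->
  [/\ count_u L (image_start m + c) = p * count_u L m + p.-1 * count_u M m + c,
      count_u S (image_start m + c) = count_u L m + count_u M m &
      count_u M (image_start m + c) = count_u S m].
Proof.
move=> c_lt; rewrite /count_u prefix_u_image ?(ltnW c_lt) //.
rewrite !count_cat !count_phi_word take_phi //=.
by rewrite !count_cat !count_nseq /=; split; lia.
Qed.

Lemma count_u_sum n : count_u L n + count_u S n + count_u M n = n.
Proof.
rewrite /count_u -[RHS](size_mkseq (u p)).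
by elim: (mkseq _ _) => //= -[] w IHw /=; lia.
Qed.

Definition preimages a : seq (letter * nat) :=
  [seq x <- [seq (b, c) | b <- [:: L; S; M], c <- iota 0 p.+1]
     | (x.2 < size (phi p x.1)) && (a == nth L (phi p x.1) x.2)].

Lemma size_phi_le a : size (phi p a) <= p.+1.
Proof. by case: a; rewrite //= size_cat size_nseq addn1 ltnS ?leq_pred. Qed.

Lemma mem_preimages a b c : c < size (phi p b) -> a = nth L (phi p b) c ->
  (b, c) \in preimages a.
Proof.
move=> c_lt Ea; rewrite mem_filter c_lt Ea eqxx.
apply/allpairsPdep; exists b, c; split=> //; first by case: b {c_lt Ea}.
by rewrite mem_iota /= (leq_trans c_lt) ?size_phi_le.
Qed.

Lemma u0 : u p 0 = L.
Proof. by move: p_gt1; rewrite /u /phi_iter; case: p. Qed.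

Lemma image_start_gt m : 0 < m -> m < image_start m.
Proof.
case: m => // m _; elim: m => [|m IHm].
  by rewrite image_startS u0 /image_start /= size_cat size_nseq /=; lia.
by rewrite image_startS -addn1 leq_add // size_phi_gt0.
Qed.

(** The truncated [n.-1] covers both cases: the parent of n > 0 is strictly smaller, and position 0
    is its own parent. *)
Lemma image_startP n : exists m c,
  [/\ n = image_start m + c, c < size (phi p (u p m)) & m <= n.-1].
Proof.
elim: n => [|n [m [c [En c_lt _]]]]; first by exists 0, 0; split; rewrite ?size_phi_gt0.
have m_le : m <= image_start m by case: (posnP m) => [->|/image_start_gt/ltnW].
have [cS_lt|cS_ge] := ltnP c.+1 (size (phi p (u p m))).
  by exists m, c.+1; split; rewrite ?En ?addnS //=; lia.
have En1 : n.+1 = image_start m.+1 by rewrite image_startS En; lia.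
exists m.+1, 0; split; rewrite ?addn0 ?size_phi_gt0 //.
rewrite En1 -ltnS prednK ?image_start_gt //.
by case: (image_start _) (image_start_gt (ltn0Sn m)).
Qed.

End FixedPoint.

(** * Explicit unbalanced factors *)

Lemma count_factor p a i k :
  count_mem a [seq u p (i + j) | j <- iota 0 k] + count_u p a i = count_u p a (i + k).
Proof.
rewrite /count_u /mkseq iotaD map_cat count_cat addnC -[0 + i]addnC iotaDl.
by rewrite -map_comp.
Qed.

Lemma balancedP p a c :
  (forall i j k, count_u p a (i + k) + count_u p a j <=
                 count_u p a i + count_u p a (j + k) + c) ->
  balanced c (u p) a.
Proof.
move=> bound v w [i Ev] [j Ew] size_eq; rewrite Ev Ew -size_eq.
have := bound i j (size v); rewrite -!count_factor; lia.
Qed.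

(** * Letter counts at positions given by digits *)

Section Addresses.
Variable p : nat.
Hypothesis p_gt1 : 1 < p.

(** The position need not be recorded: it is l + s + m. *)
Definition located a l s m := exists n,
  [/\ u p n = a, count_u p L n = l, count_u p S n = s & count_u p M n = m].

Lemma located0 : located L 0 0 0.
Proof. by exists 0; split; rewrite ?u0. Qed.

Lemma located_step b c l s m : located b l s m -> c < size (phi p b) ->
  located (nth L (phi p b) c) (p * l + p.-1 * m + c) (l + m) s.
Proof.
move=> [n [Eb El Es Em]]; rewrite -Eb => c_lt.
exists (image_start p n + c); have [-> -> ->] := count_u_image p_gt1 c_lt.
by rewrite u_image // El Es Em.
Qed.

Lemma located_LL c l s m : located L l s m -> c < p ->
  located L (p * l + p.-1 * m + c) (l + m) s.
Proof.
move=> loc c_lt; have := located_step (c := c) loc.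
rewrite /= size_cat size_nseq nth_cat size_nseq c_lt nth_nseq c_lt.
by apply; rewrite addn1 ltnS ltnW.
Qed.

Lemma located_LS l s m : located L l s m ->
  located S (p * l + p.-1 * m + p) (l + m) s.
Proof.
move=> loc; have := located_step (c := p) loc.
rewrite /= size_cat size_nseq nth_cat size_nseq.
by rewrite ltnn subnn; apply; rewrite addn1.
Qed.

Lemma located_SM l s m : located S l s m ->
  located M (p * l + p.-1 * m + 0) (l + m) s.
Proof. by move=> loc; apply: (located_step loc (c := 0)). Qed.

Lemma located_ML c l s m : located M l s m -> c < p.-1 ->
  located L (p * l + p.-1 * m + c) (l + m) s.
Proof.
move=> loc c_lt; have := located_step (c := c) loc.
rewrite /= size_cat size_nseq nth_cat size_nseq c_lt nth_nseq c_lt.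
by apply; rewrite addn1 ltnS ltnW.
Qed.

Lemma located_MS l s m : located M l s m ->
  located S (p * l + p.-1 * m + p.-1) (l + m) s.
Proof.
move=> loc; have := located_step (c := p.-1) loc.
rewrite /= size_cat size_nseq nth_cat size_nseq.
by rewrite ltnn subnn; apply; rewrite addn1.
Qed.

Definition letter_count (a : letter) (l s m : nat) :=
  match a with L => l | S => s | M => m end.

(* The two factors are those from position 2 to 1 and from position 4 to 3. *)
Lemma not_balanced a k x1 l1 s1 m1 x2 l2 s2 m2 x3 l3 s3 m3 x4 l4 s4 m4 :
  located x1 l1 s1 m1 -> located x2 l2 s2 m2 ->
  located x3 l3 s3 m3 -> located x4 l4 s4 m4 ->
  l2 + s2 + m2 <= l1 + s1 + m1 ->
  l1 + s1 + m1 + (l4 + s4 + m4) = l2 + s2 + m2 + (l3 + s3 + m3) ->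
  letter_count a l2 s2 m2 + letter_count a l3 s3 m3 + k
    < letter_count a l1 s1 m1 + letter_count a l4 s4 m4 ->
  ~ balanced k (u p) a.
Proof.
move=> [n1 [_ El1 Es1 Em1]] [n2 [_ El2 Es2 Em2]].
move=> [n3 [_ El3 Es3 Em3]] [n4 [_ El4 Es4 Em4]].
have E1 := count_u_sum p_gt1 n1; have E2 := count_u_sum p_gt1 n2.
have E3 := count_u_sum p_gt1 n3; have E4 := count_u_sum p_gt1 n4.
move=> n_le n_eq gap bal.
pose word i := [seq u p (i + j) | j <- iota 0 (n1 - n2)].
have fac i : factor (u p) (word i) by exists i; rewrite size_map size_iota.
have := bal _ _ (fac n2) (fac n4); rewrite !size_map => /(_ erefl).
have := count_factor p a n2 (n1 - n2); have := count_factor p a n4 (n1 - n2).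
have -> : n2 + (n1 - n2) = n1 by lia.
have -> : n4 + (n1 - n2) = n3 by lia.
rewrite -/(word n2) -/(word n4).
by clear bal; case: a gap => /=; lia.
Qed.
End Addresses.

(** Computable iteration of [located_step], with the offset at the oldest ancestor first; an offset
    outside its image gives [None]. *)
Fixpoint follow p (st : letter * nat * nat * nat) (digits : seq nat) :
    option (letter * nat * nat * nat) :=
  let: (b, l, s, m) := st in
  if digits is c :: digits' then
    if c < size (phi p b) then
      follow p (nth L (phi p b) c, p * l + p.-1 * m + c, l + m, s) digits'
    else None
  else Some st.

Lemma followP p b l s m digits a l' s' m' : 1 < p -> located p b l s m ->
  follow p (b, l, s, m) digits = Some (a, l', s', m') -> located p a l' s' m'.
Proof.
move=> p_gt1; elim: digits b l s m => [|c digits IHd] b l s m b_loc /=.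
  by case=> <- <- <- <-.
by case: ifP => // c_lt; apply: IHd; apply: located_step.
Qed.

Lemma located2 digits a l s m :
  follow 2 (L, 0, 0, 0) digits = Some (a, l, s, m) -> located 2 a l s m.
Proof. by apply: followP; last exact: located0. Qed.

Arguments located2 digits {a l s m}.

(** The factors have lengths 37, 10 and 7, with 22 against 19 letters L, 4 against 2 letters S, and
    2 against 0 letters M. *)
Lemma not_balanced2 :
  [/\ ~ balanced 2 (u 2) L, ~ balanced 1 (u 2) S & ~ balanced 1 (u 2) M].
Proof.
split.
- by apply: (not_balanced (p := 2) isT (located2 [:: 1; 0; 1; 1; 1; 2] erefl)
    (located2 [:: 2; 0; 0; 0; 0] erefl) (located2 [:: 1; 0; 0; 0; 0; 0; 0] erefl)
    (located2 [:: 1; 1; 1; 1; 1; 2] erefl)).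
- by apply: (not_balanced (p := 2) isT (located2 [:: 1; 0; 1; 0] erefl)
    (located2 [:: 1; 0; 2] erefl) (located2 [:: 1; 0; 1; 0; 2] erefl)
    (located2 [:: 2; 0; 1; 0] erefl)).
- by apply: (not_balanced (p := 2) isT (located2 [:: 1; 0; 0; 0; 0] erefl)
    (located2 [:: 1; 1; 2; 0] erefl) (located2 [:: 1; 0; 1; 2] erefl)
    (located2 [:: 2; 0; 0] erefl)).
Qed.

(** The factors have lengths p^2 + p + 2, p^2 + 2p + 2 and p^2 + p + 1, with p^2 + 2 against p^2 - 1
    letters L, p + 2 against p letters S, and 2 against 0 letters M. *)
Lemma not_balanced_gt2 p : 2 < p ->
  [/\ ~ balanced 2 (u p) L, ~ balanced 1 (u p) S & ~ balanced 1 (u p) M].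
Proof.
case: p => [|[|[|q]]] // _; set p := q.+3.
have p_gt1 : 1 < p by [].
have LL := located_LL p_gt1; have LS := located_LS p_gt1.
have root c : c < p -> located p L c 0 0.
  by move=> c_lt; have := LL c _ _ _ (located0 p_gt1) c_lt; rewrite !muln0.
have rootS : located p S p 0 0 by have := LS _ _ _ (located0 p_gt1); rewrite !muln0.
have root1 := root 1 isT; have rootp1 := root p.-1 (ltnSn _).
(* Names list the digits; [p] is the digit p in [xp0] and [xp00], but p - 1 in [x10p] and [xpp]. *)
have x10 := LL 0 _ _ _ root1 isT.
have xp0 := located_SM p_gt1 rootS.
have xp00 := located_ML p_gt1 xp0 (isT : 0 < p.-1).
have x1000 := LL 0 _ _ _ (LL 0 _ _ _ x10 isT) isT.
have x10000 := LL 0 _ _ _ x1000 isT.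
have x10p := LL p.-1 _ _ _ x10 (ltnSn _).
have xpp := LL p.-1 _ _ _ rootp1 (ltnSn _).
split.
(* Digit 3 leads to S if p = 3 and to L otherwise, so the general [located_step] is used. *)
- have c_lt : 3 < size (phi p L) by rewrite /= size_cat size_nseq addn1.
  by apply: (not_balanced p_gt1 (located_step p_gt1 x10p c_lt) xp00 x10000
              (LS _ _ _ (LL p.-1 _ _ _ xpp (ltnSn _)))); rewrite /p /=; nia.
- by apply: (not_balanced p_gt1 (LL 0 _ _ _ (LL 1 _ _ _ x10 isT) isT)
              (LS _ _ _ (LL 0 _ _ _ rootp1 isT))
              (LS _ _ _ (LL 0 _ _ _ (root 2 isT) isT)) xp0); rewrite /p /=; nia.
- by apply: (not_balanced p_gt1 x10000 (located_SM p_gt1 (LS _ _ _ xpp))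
              (LL 2 _ _ _ x10p isT) xp00); rewrite /p /=; nia.
Qed.

(** * Linear functionals bounded on all prefixes *)

Import Order.TTheory GRing.Theory Num.Theory.
Local Open Scope ring_scope.

(** * Polynomial inequalities in t *)

Section Inequalities.
Variables (R : realFieldType) (t : R).
Hypotheses (t_gt0 : 0 < t) (t_le : t <= 1 / 2).

(* [digit_lo b a] and [digit_hi b a] bound [t * c] when [a] is the letter of
   [phi p b] at offset [c]; note that [t * p = 1 - t ^+ 2 + t ^+ 3]. *)
Definition allowed (b a : letter) : bool :=
  match b, a with L, L | L, S | S, M | M, L | M, S => true | _, _ => false end.

Definition digit_lo (b a : letter) : R :=
  match b, a with
  | L, S => 1 - t ^+ 2 + t ^+ 3
  | M, S => 1 - t - t ^+ 2 + t ^+ 3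
  | _, _ => 0
  end.

Definition digit_hi (b a : letter) : R :=
  match b, a with
  | L, L | M, S => 1 - t - t ^+ 2 + t ^+ 3
  | L, S => 1 - t ^+ 2 + t ^+ 3
  | M, L => 1 - t *+ 2 - t ^+ 2 + t ^+ 3
  | _, _ => 0
  end.

(* Intervals stable under the recursion for [zeta], close to the optimal ones
   for small [t]. *)
Definition zeta_lo (a : letter) : R :=
  match a with
  | L => - t - t ^+ 3 - t ^+ 4
  | S => 1 - t - t ^+ 2 - t ^+ 4
  | M => - t - t ^+ 2 - t ^+ 4
  end.

Definition zeta_hi (a : letter) : R :=
  match a with
  | L => 1 + t ^+ 3
  | S => 1 + t + t ^+ 3
  | M => t ^+ 2 *+ 2 + t ^+ 5
  end.

(** With these relations between consecutive powers, [lra] can treat each power of t as a separate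
    unknown. *)
Lemma t_powers q : t <= q ->
  (0 <= t ^+ 2 <= t * q /\ 0 <= t ^+ 3 <= t ^+ 2 * q) /\
  (0 <= t ^+ 4 <= t ^+ 3 * q /\ 0 <= t ^+ 5 <= t ^+ 4 * q) /\
  (0 <= t ^+ 6 <= t ^+ 5 * q /\ 0 <= t ^+ 7 <= t ^+ 6 * q) /\
  (0 <= t ^+ 8 <= t ^+ 7 * q /\ 0 <= t ^+ 9 <= t ^+ 8 * q) /\
  0 <= t ^+ 10 <= t ^+ 9 * q.
Proof.
move=> t_leq.
have next n : 0 <= t ^+ n.+1 <= t ^+ n * q.
  have tn_ge0 : 0 <= t ^+ n by rewrite exprn_ge0 // ltW.
  by rewrite exprSr mulr_ge0 ?(ltW t_gt0) //= ler_wpM2l.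
by do !split; exact: next.
Qed.

Lemma scaled_bounds (k x lo hi : R) : 0 <= k -> lo <= x <= hi ->
  0 <= k * (x - lo) /\ 0 <= k * (hi - x).
Proof. by move=> k_ge0 /andP[? ?]; split; rewrite mulr_ge0 ?subr_ge0. Qed.

(** The expression is affine in [d], [zb] and [ze], so for each path of letters its extremes lie at
    interval ends, leaving polynomial inequalities in t. *)
Lemma zeta_step (a b e : letter) (d zb ze : R) :
  allowed b a -> allowed e b -> digit_lo b a <= d <= digit_hi b a ->
  zeta_lo b <= zb <= zeta_hi b -> zeta_lo e <= ze <= zeta_hi e ->
  zeta_lo a <= d - (t - t ^+ 2) * zb + t * ze <= zeta_hi a.
Proof.
have [[t2 t3] [[t4 t5] [[t6 t7] _]]] := t_powers t_le.
move=> ba eb d_in.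
move/(scaled_bounds (k := t - t ^+ 2)) => /(_ ltac:(lra)) zb_in.
move/(scaled_bounds (k := t)) => /(_ ltac:(lra)) ze_in.
move: ba eb d_in zb_in ze_in.
by case: a; case: b => //; case: e => //= _ _ ? [? ?] [? ?]; lra.
Qed.

(** The sum [zeta] + [zeta_parent] is expanded over two generations, since separate bounds for its
    two terms would ignore their correlation. *)
Lemma zeta_sum_step (a b e f : letter) (d d' ze zf : R) :
  t <= 9 / 20 ->
  allowed b a -> allowed e b -> allowed f e ->
  digit_lo b a <= d <= digit_hi b a -> digit_lo e b <= d' <= digit_hi e b ->
  zeta_lo e <= ze <= zeta_hi e -> zeta_lo f <= zf <= zeta_hi f ->
  - 2 * t ^+ 2 <= d + (1 - t + t ^+ 2) * (d' - (t - t ^+ 2) * ze + t * zf) + t * ze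
    <= 2 - t + 2 * t ^+ 2.
Proof.
move=> t_leq.
have [[t2 t3] [[t4 t5] [[t6 t7] [[t8 t9] t10]]]] := t_powers t_leq.
move=> ba eb fe d_in.
move/(scaled_bounds (k := 1 - t + t ^+ 2)) => /(_ ltac:(lra)) d'_in.
(* Net coefficient of [ze] after expansion. *)
move/(scaled_bounds (k := t ^+ 2 + (t - t ^+ 2) ^+ 2)) => /(_ ltac:(nra)) ze_in.
move/(scaled_bounds (k := t * (1 - t + t ^+ 2))) => /(_ ltac:(nra)) zf_in.
move: ba eb fe d_in d'_in ze_in zf_in.
by case: a; case: b => //; case: e => //; case: f => //= _ _ _ ? [? ?] [? ?] [? ?]; lra.
Qed.

Lemma zeta_M_step (a b e f : letter) (d d' ze zf : R) :
  t <= 1 / 4 ->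
  allowed b a -> allowed e b -> allowed f e ->
  digit_lo b a <= d <= digit_hi b a -> digit_lo e b <= d' <= digit_hi e b ->
  zeta_lo e <= ze <= zeta_hi e -> zeta_lo f <= zf <= zeta_hi f ->
  - t - t ^+ 2 <= t * d + (1 + t - t * (t - t ^+ 2)) * (d' - (t - t ^+ 2) * ze + t * zf)
      + t ^+ 2 * ze
    <= 1 + 2 * t + t ^+ 2 * (3 / 4).
Proof.
move=> t_leq.
have [[t2 t3] [[t4 t5] [[t6 t7] [[t8 t9] t10]]]] := t_powers t_leq.
move=> ba eb fe.
move/(scaled_bounds (k := t)) => /(_ ltac:(lra)) d_in.
move/(scaled_bounds (k := 1 + t - t * (t - t ^+ 2))) => /(_ ltac:(lra)) d'_in.
(* Here the net coefficient of [ze] is negative; [k] is its opposite. *)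
move/(scaled_bounds (k := (1 + t - t * (t - t ^+ 2)) * (t - t ^+ 2) - t ^+ 2)).
move=> /(_ ltac:(lra)) ze_in.
move/(scaled_bounds (k := t * (1 + t - t * (t - t ^+ 2)))) => /(_ ltac:(lra)) zf_in.
move: ba eb fe d_in d'_in ze_in zf_in.
by case: a; case: b => //; case: e => //; case: f => //=;
  move=> _ _ _ [? ?] [? ?] [? ?] [? ?]; lra.
Qed.
End Inequalities.

(** * Recursion and bounds for [zeta] on prefixes *)

Section Discrepancy.
Variable p : nat.
Hypothesis p_gt1 : (1 < p)%N.
Variables (R : realFieldType) (t : R).
Hypotheses (t_gt0 : 0 < t) (t_le : t <= 1 / 2).
Hypothesis t_root : p%:R * t = 1 - t ^+ 2 + t ^+ 3.

Local Notation cnt a n := (count_u p a n).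
Local Notation Image := (image_start p).

Definition zeta n : R := t * (cnt L n + cnt M n)%:R - (cnt S n)%:R.
(** The value of [zeta] at the parent of n, written with the counts at n so that it is linear in
    them. *)
Definition zeta_parent n : R := t * (cnt S n)%:R - (cnt M n)%:R.

Lemma zeta_parentE m c : (c < size (phi p (u p m)))%N ->
  zeta_parent (Image m + c) = zeta m.
Proof. by move=> /(count_u_image p_gt1)[_ ES EM]; rewrite /zeta_parent ES EM. Qed.

Lemma zeta_image m c : (c < size (phi p (u p m)))%N ->
  zeta (Image m + c) = t * c%:R - (t - t ^+ 2) * zeta m + t * zeta_parent m.
Proof.
move=> /(count_u_image p_gt1)[EL ES EM]; rewrite /zeta /zeta_parent EL ES EM.
have -> : p.-1 = (p - 1)%N by lia.
rewrite !natrD !natrM natrB; last exact: ltnW.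
have Ep : forall x, t * (p%:R * x) = (1 - t ^+ 2 + t ^+ 3) * x.
  by move=> x; rewrite mulrA [t * _]mulrC t_root.
have := Ep (cnt L m)%:R; have := Ep (cnt M m)%:R; lra.
Qed.

Lemma digit_bounds b c : (c < size (phi p b))%N ->
  allowed b (nth L (phi p b) c) /\
  digit_lo t b (nth L (phi p b) c) <= t * c%:R <= digit_hi t b (nth L (phi p b) c).
Proof.
have nth_phi q : (q < p.+1)%N -> (c <= q)%N ->
    nth L (nseq q L ++ [:: S]) c = if c == q then S else L.
  rewrite nth_cat size_nseq nth_nseq => _ c_le; case: ltngtP c_le => // -> _.
  by rewrite subnn.
have tp : t * p%:R = 1 - t ^+ 2 + t ^+ 3 by rewrite mulrC.
have tc_ge0 : 0 <= t * c%:R by rewrite mulr_ge0 ?ler0n // ltW.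
have tc_le k : (c + k <= p)%N -> t * c%:R <= t * p%:R - t * k%:R.
  by move=> le; rewrite -mulrBr ler_pM2l // lerBrDr -natrD ler_nat.
case: b => /=; rewrite ?size_cat ?size_nseq ?addn1 ?ltnS.
- move=> c_le; rewrite nth_phi //; case: eqP => [->|ne] /=; first by split=> //; lra.
  by have := tc_le 1%N ltac:(lia); split=> //; lra.
- by case: c {tc_ge0 tc_le nth_phi} => // _ /=; rewrite mulr0 lexx.
- move=> c_le; rewrite nth_phi //; last by lia.
  have pE : p = p.-1.+1 by lia.
  case: eqP => [Ec|ne] /=; last by have := tc_le 2 ltac:(lia); split=> //; lra.
  have : t * c%:R = t * p%:R - t by rewrite Ec [in RHS]pE -addn1 natrD mulrDr mulr1 addrK.
  by split=> //; lra.
Qed.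

(** Strong induction: the recursion refers to the parent and the grandparent, both smaller once n >
    0. *)
Lemma zeta_bounds n : zeta_lo t (u p n) <= zeta n <= zeta_hi t (u p n).
Proof.
elim/ltn_ind: n => n IHn.
have [n0|n_gt0] := posnP n.
  have [[t2 t3] [[t4 t5] _]] := t_powers t_gt0 t_le.
  by rewrite n0 u0 // /zeta /count_u /= mulr0 subr0; lra.
have [m [c [En c_lt m_le]]] := image_startP p_gt1 n.
have [k [c' [Em c'_lt k_le]]] := image_startP p_gt1 m.
rewrite En u_image // zeta_image //.
have [ba d_in] := digit_bounds c_lt; have [eb _] := digit_bounds c'_lt.
have -> : zeta_parent m = zeta k by rewrite Em zeta_parentE.
have Em' : u p m = nth L (phi p (u p k)) c' by rewrite Em u_image.
apply: (@zeta_step _ t t_gt0 t_le _ (u p m) (u p k)) => //; first by rewrite Em'.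
- by apply: IHn; lia.
- by apply: IHn; lia.
Qed.

(** The letters [a], [b], [e], [f] belong to n and its three nearest ancestors; [d], [d'] are
    offsets times t. *)
Lemma zeta_path n : exists a b e f d d' ze zf,
  [/\ allowed b a, allowed e b & allowed f e] /\
  [/\ digit_lo t b a <= d <= digit_hi t b a, digit_lo t e b <= d' <= digit_hi t e b,
   zeta_lo t e <= ze <= zeta_hi t e & zeta_lo t f <= zf <= zeta_hi t f] /\
  zeta_parent n = d' - (t - t ^+ 2) * ze + t * zf /\
  zeta n = d - (t - t ^+ 2) * zeta_parent n + t * ze.
Proof.
have [m [c [En c_lt _]]] := image_startP p_gt1 n.
have [k [c' [Em c'_lt _]]] := image_startP p_gt1 m.
have [h [c'' [Ek c''_lt _]]] := image_startP p_gt1 k.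
have [ba d_in] := digit_bounds c_lt; have [eb d'_in] := digit_bounds c'_lt.
have [fe _] := digit_bounds c''_lt.
exists (u p n), (u p m), (u p k), (u p h), (t * c%:R), (t * c'%:R), (zeta k), (zeta h).
rewrite -u_image // -En in ba d_in; rewrite -u_image // -Em in eb d'_in.
rewrite -u_image // -Ek in fe.
split=> //; split; first by split=> //; apply: zeta_bounds.
have Pn : zeta_parent n = zeta m by rewrite En zeta_parentE.
have Pm : zeta_parent m = zeta k by rewrite Em zeta_parentE.
have Pk : zeta_parent k = zeta h by rewrite Ek zeta_parentE.
rewrite Pn -Pk -Pm; split.
  by rewrite {1}Em zeta_image // Pm.
by rewrite {1}En zeta_image.
Qed.

Lemma zeta_sum_bounds n : t <= 9 / 20 ->
  - 2 * t ^+ 2 <= zeta n + zeta_parent n <= 2 - t + 2 * t ^+ 2.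
Proof.
move=> t_le'.
have [a [b [e [f [d [d' [ze [zf [[ba eb fe] [[? ? ? ?] [Ey Ez]]]]]]]]]]] := zeta_path n.
have := @zeta_sum_step _ t t_gt0 a b e f d d' ze zf t_le' ba eb fe.
by rewrite -Ey => /(_ ltac:(done) ltac:(done) ltac:(done) ltac:(done)); rewrite Ez; lra.
Qed.

Lemma zeta_M_bounds n : t <= 1 / 4 ->
  - t - t ^+ 2 <= t * zeta n + (1 + t) * zeta_parent n <= 1 + 2 * t + t ^+ 2 * (3 / 4).
Proof.
move=> t_le'.
have [a [b [e [f [d [d' [ze [zf [[ba eb fe] [[? ? ? ?] [Ey Ez]]]]]]]]]]] := zeta_path n.
have := @zeta_M_step _ t t_gt0 a b e f d d' ze zf t_le' ba eb fe.
by rewrite -Ey => /(_ ltac:(done) ltac:(done) ltac:(done) ltac:(done)); rewrite Ez; lra.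
Qed.

End Discrepancy.

(** * Balance for p at least 4 *)

(** Intermediate value theorem on [0, 1/2]: the polynomial is -1 at 0 and at least 1/8 at 1/2. *)
Lemma perron_root (R : rcfType) p : (1 < p)%N ->
  exists t : R, [/\ 0 < t, t <= 1 / 2 & p%:R * t = 1 - t ^+ 2 + t ^+ 3].
Proof.
move=> p_gt1; have p_ge2 : 2 <= p%:R :> R by rewrite ler_nat.
pose q : {poly R} := 'X * (p%:R)%:P - 1 + 'X^2 - 'X^3.
have qE x : q.[x] = x * p%:R - 1 + x ^+ 2 - x ^+ 3 by rewrite !hornerE.
have [||t /andP[t_ge0 t_le] /rootP] := @poly_ivt R q 0 (1 / 2).
- by rewrite div1r invr_ge0 ler0n.
- by rewrite !qE; apply/andP; split; lra.
rewrite qE => qt; exists t; split=> //; last by lra.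
rewrite lt_neqAle t_ge0 andbT; apply/negP => /eqP t0.
by move: qt; rewrite -t0; lra.
Qed.

Section Differences.
Variable p : nat.
Local Notation cnt a n := (count_u p a n).

(* For the factors from [d] to [b] and from [c] to [e]. *)
Definition diff a b c d e : int :=
  (cnt a b + cnt a c)%:Z - (cnt a d + cnt a e)%:Z.

Variables (R : realFieldType) (t : R).

Lemma zeta_diff b c d e :
  zeta p t b + zeta p t c - zeta p t d - zeta p t e =
  t * (diff L b c d e + diff M b c d e)%:~R - (diff S b c d e)%:~R.
Proof. by rewrite /zeta /diff !rmorphD !rmorphN /= -!pmulrn !natrD; ring. Qed.

Lemma zeta_parent_diff b c d e :
  zeta_parent p t b + zeta_parent p t c - zeta_parent p t d - zeta_parent p t e =
  t * (diff S b c d e)%:~R - (diff M b c d e)%:~R.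
Proof. by rewrite /zeta_parent /diff !rmorphD !rmorphN /= -!pmulrn !natrD; ring. Qed.
End Differences.

Section LargeP.
Variable p : nat.
Hypothesis p_ge4 : (4 <= p)%N.

Lemma diff_bounds_large b c d e : (b + c = d + e)%N ->
  [/\ diff p L b c d e < 4, diff p S b c d e < 3 & diff p M b c d e < 3].
Proof.
move=> sum_eq; have p_gt1 : (1 < p)%N by lia.
have [t [t_gt0 t_le t_root]] := perron_root realalg p_gt1.
have t_lt4 : t < 1 / 4.
  have : 4%:R * t <= p%:R * t by rewrite ler_pM2r // ler_nat.
  have : 0 < t ^+ 2 * (1 - t) by rewrite mulr_gt0 ?exprn_gt0 //; lra.
  by rewrite t_root; lra.
have sum0 : diff p L b c d e + diff p S b c d e + diff p M b c d e = 0.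
  rewrite /diff; have := count_u_sum p_gt1 b; have := count_u_sum p_gt1 c.
  by have := count_u_sum p_gt1 d; have := count_u_sum p_gt1 e; lia.
have Ez := zeta_diff p t b c d e; have Ey := zeta_parent_diff p t b c d e.
set l := diff p L b c d e in sum0 Ez *; set s := diff p S b c d e in sum0 Ez Ey *.
set m := diff p M b c d e in sum0 Ez Ey *.
have [[t2 t3] [[t4 t5] _]] := t_powers t_gt0 (ltW t_lt4).
(* Over all letters the lowest end is that of M and the highest that of S. *)
have z_in n : - t - t ^+ 2 - t ^+ 4 <= zeta p t n <= 1 + t + t ^+ 3.
  have := zeta_bounds p_gt1 t_gt0 t_le t_root n.
  by case: (u p n) => /=; lra.
have w_in n : - 2 * t ^+ 2 <= zeta p t n + zeta_parent p t n <= 2 - t + 2 * t ^+ 2.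
  by apply: (zeta_sum_bounds p_gt1 t_gt0 t_le t_root); lra.
have m_in n := zeta_M_bounds p_gt1 t_gt0 t_le t_root n (ltW t_lt4).
have sR : l%:~R + s%:~R + m%:~R = 0 :> realalg by rewrite -!rmorphD sum0.
have El : l%:~R = - s%:~R - m%:~R :> realalg by lra.
rewrite rmorphD /= El in Ez.
split.
- rewrite ltNge; apply/negP; rewrite -(ler_int realalg) El => l_ge.
  have [] := (w_in b, w_in c); have [] := (w_in d, w_in e).
  (* Twice the range in [w_in] is 4 - 2t(1 - 4t), which is below 4 exactly because 0 < t < 1/4. *)
  have : 0 < t * (1 - 4 * t) by rewrite mulr_gt0 //; lra.
  lra.
- rewrite ltNge; apply/negP; rewrite -(ler_int realalg) => s_ge.
  have [] := (z_in b, z_in c); have [] := (z_in d, z_in e).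
  have : 3 * t <= s%:~R * t by rewrite ler_pM2r.
  lra.
- rewrite ltNge; apply/negP; rewrite -(ler_int realalg) => m_ge.
  have [] := (m_in b, m_in c); have [] := (m_in d, m_in e).
  have : 3 * (1 + t) <= m%:~R * (1 + t) by rewrite ler_pM2r //; lra.
  have : t * (zeta p t b + zeta p t c - zeta p t d - zeta p t e)
     = - (t * (1 + t) * s%:~R).
    by rewrite Ez; ring.
  have : (1 + t) * (zeta_parent p t b + zeta_parent p t c - zeta_parent p t d
      - zeta_parent p t e)
     = t * (1 + t) * s%:~R - (1 + t) * m%:~R by rewrite Ey; ring.
  lra.
Qed.
End LargeP.

(** * Backward search for p = 2 and p = 3 *)

(* The differences of the counts of L, S and M, the letters at the two end points
   counted positively, and those at the two end points counted negatively; both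
   pairs of letters are unordered. *)
Definition node : Type := (int * int * int * (letter * letter) * (letter * letter))%type.

Definition letter_rank (a : letter) : nat := match a with L => 0 | S => 1 | M => 2 end.

Definition sort_pair (a b : letter) : letter * letter :=
  if (letter_rank a <= letter_rank b)%N then (a, b) else (b, a).

Lemma sort_pairC a b : sort_pair a b = sort_pair b a.
Proof. by case: a; case: b. Qed.

(** Only the sum of the two offsets enters the counts, so keeping just this sum reduces the
    branching. *)
Definition preimage_pairs p (P : letter * letter) : seq (letter * letter * nat) :=
  undup [seq (sort_pair x.1 y.1, x.2 + y.2)%N 
           | x <- preimages p P.1, y <- preimages p P.2].

(** Inverts the map of [count_u_image]; the incidence matrix has determinant -1, so the solution is
    integral. *)
Definition predecessors p (nd : node) : seq node :=
  let: (l, s, m, P, Q) := nd in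
  [seq let a := l - (x.2%:Z - y.2%:Z) in
       (a - p.-1%:Z * s, m, p%:Z * s - a, x.1, y.1)
     | x <- preimage_pairs p P, y <- preimage_pairs p Q].

(* Integer bounds for [20 * t], [20 * zeta] (by letter) and
   [20 * (zeta + zeta_parent)]. *)
Record bounds := Bounds {
  t_min : int; t_max : int;
  z_min : letter -> int; z_max : letter -> int;
  w_min : int; w_max : int }.

(** Necessary for 20 t k <= v: the left side is least at one end of the interval for 20 t, depending
    on the sign of k. *)
Definition le_scaled B (k v : int) := (k * t_min B <= v) || (k * t_max B <= v).

(** The alternating sums of [zeta] and of [zeta + zeta_parent] must fit their ranges. The term l + s
    + m is kept because parents of factors of equal length may delimit unequal lengths. *)
Definition admissible B (nd : node) : bool :=
  let: (l, s, m, P, Q) := nd in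
  let w := (w_max B - w_min B) * 2%Z in
  [&& le_scaled B (l + m)
        (z_max B P.1 + z_max B P.2 - z_min B Q.1 - z_min B Q.2 + 20%Z * s),
      le_scaled B (- (l + m))
        (z_max B Q.1 + z_max B Q.2 - z_min B P.1 - z_min B P.2 - 20%Z * s),
      le_scaled B (l + s + m) (w + 20%Z * (s + m)) &
      le_scaled B (- (l + s + m)) (w - 20%Z * (s + m))].

(* Filtering twice, since [&&] is strict under [vm_compute]. *)
Fixpoint explore p B fuel (seen front : seq node) : seq node :=
  if fuel is k.+1 then
    let new := undup [seq x <- [seq x <- flatten (map (predecessors p) front)
                                    | admissible B x]
                       | x \notin seen] in
    explore p B k (new ++ seen) new
  else seen.

Definition unbalanced_nodes B : seq node :=
  let pairs := [:: (L, L); (L, S); (L, M); (S, S); (S, M); (M, M)] in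
  let diffs := [seq (l, s, - l - s) | l <- [:: 0; 1; 2; 3; 4; -1; -2; -3; -4]%Z,
                                      s <- [:: 0; 1; 2; 3; -1; -2; -3]%Z] in
  [seq x <- [seq (x, Q) | x <- [seq (D, P) | D <- diffs, P <- pairs], Q <- pairs]
     | (let: (l, s, m, _, _) := x in [|| 4%Z <= l, 3%Z <= s | 3%Z <= m])
       && admissible B x].

(** A certificate checked on the final set, so neither the fuel nor the completeness of [explore]
    has to be justified. *)
Definition closed_nodes p B (bad : seq node) : bool :=
  all (fun nd => all (mem bad) (filter (admissible B) (predecessors p nd))) bad
  && all (fun nd : node => nd.1.1 != (0%Z, 0%Z, 0%Z)) bad.

Lemma sub_explore p B fuel (seen front : seq node) :
  {subset seen <= explore p B fuel seen front}.
Proof.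
elim: fuel seen front => [|k IHk] seen front x x_seen //=.
by apply: IHk; rewrite mem_cat x_seen orbT.
Qed.

Lemma mem_preimage_pairs p a b a' b' c d :
  (a', c) \in preimages p a -> (b', d) \in preimages p b ->
  (sort_pair a' b', c + d)%N \in preimage_pairs p (sort_pair a b).
Proof.
move=> a'_in b'_in; rewrite mem_undup [sort_pair a b]/sort_pair.
case: ifP => _ /=; apply/allpairsP.
  by exists ((a', c), (b', d)).
by exists ((b', d), (a', c)); rewrite addnC sort_pairC.
Qed.

(** * Soundness of the backward search *)

Section Soundness.
Variables (p : nat) (B : bounds) (R : realFieldType) (t : R).
Hypothesis p_gt1 : (1 < p)%N.
Hypothesis t_in : (t_min B)%:~R <= 20 * t <= (t_max B)%:~R.
Hypothesis z_in : forall n,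
  (z_min B (u p n))%:~R <= 20 * zeta p t n <= (z_max B (u p n))%:~R.
Hypothesis w_in : forall n,
  (w_min B)%:~R <= 20 * (zeta p t n + zeta_parent p t n) <= (w_max B)%:~R.

Definition config b c d e : node :=
  (diff p L b c d e, diff p S b c d e, diff p M b c d e,
   sort_pair (u p b) (u p c), sort_pair (u p d) (u p e)).

Lemma le_scaledP (k v : int) : 20 * t * k%:~R <= v%:~R -> le_scaled B k v.
Proof.
rewrite /le_scaled -!(ler_int R) !rmorphM /= => le_v; case/andP: t_in => t1 t2.
have [k_ge0|k_lt0] := lerP 0 k.
  have : 0 <= k%:~R * (20 * t - (t_min B)%:~R) by rewrite mulr_ge0 ?ler0z ?subr_ge0.
  by move=> H; apply/orP; left; lra.
have : 0 <= - k%:~R * ((t_max B)%:~R - 20 * t).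
  by rewrite mulr_ge0 ?subr_ge0 // oppr_ge0 lerz0 ltW.
by move=> H; apply/orP; right; lra.
Qed.

Lemma sort_pair_sum (f : letter -> int) a b :
  f (sort_pair a b).1 + f (sort_pair a b).2 = f a + f b.
Proof. by rewrite /sort_pair; case: ifP => //= _; rewrite addrC. Qed.

Lemma admissible_config b c d e : admissible B (config b c d e).
Proof.
have Ez := zeta_diff p t b c d e; have Ey := zeta_parent_diff p t b c d e.
move: Ez Ey; rewrite /admissible /config.
(* Grouping the bounds by pair removes the dependence on the order chosen by [sort_pair]. *)
rewrite -!(addrA _ (- z_min B _) (- z_min B _)) -!opprD !sort_pair_sum.
move: (diff p L b c d e) (diff p S b c d e) (diff p M b c d e) => l s m.
rewrite !rmorphD /= => Ez Ey.
have := (z_in b, z_in c, z_in d, z_in e).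
have := (w_in b, w_in c, w_in d, w_in e).
move=> [[[wb wc] wd] we] [[[zb zc] zd] ze].
by apply/and4P; split; apply: le_scaledP;
  rewrite ?rmorphD ?rmorphN ?rmorphM /= ?rmorphD ?rmorphN /=; lra.
Qed.

Lemma config_predecessor b c d e : exists b' c' d' e',
  [/\ b' <= b.-1, c' <= c.-1, d' <= d.-1 & e' <= e.-1]%N /\
  config b' c' d' e' \in predecessors p (config b c d e).
Proof.
have [b' [ib [Eb b_lt b_le]]] := image_startP p_gt1 b.
have [c' [ic [Ec c_lt c_le]]] := image_startP p_gt1 c.
have [d' [id [Ed d_lt d_le]]] := image_startP p_gt1 d.
have [e' [ie [Ee e_lt e_le]]] := image_startP p_gt1 e.
exists b', c', d', e'; split=> //.
apply/allpairsP.
exists ((sort_pair (u p b') (u p c'), ib + ic)%N,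
        (sort_pair (u p d') (u p e'), id + ie)%N).
have pre m i : (i < size (phi p (u p m)))%N ->
    (u p m, i) \in preimages p (u p (image_start p m + i)).
  by move=> i_lt; rewrite u_image //; apply: mem_preimages.
split=> /=; rewrite ?Eb ?Ec ?Ed ?Ee; try by apply: mem_preimage_pairs; apply: pre.
have [bL bS bM] := count_u_image p_gt1 b_lt.
have [cL cS cM] := count_u_image p_gt1 c_lt.
have [dL dS dM] := count_u_image p_gt1 d_lt.
have [eL eS eM] := count_u_image p_gt1 e_lt.
have pE : p%:Z = p.-1%:Z + 1 by lia.
rewrite /config /diff bL bS bM cL cS cM dL dS dM eL eS eM.
by congr (_, _, _, _, _); rewrite ?pE; lia.
Qed.

(** Descent on b + c + d + e: parents stay in [bad] with a smaller sum, down to four zeros, whose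
    triple is excluded. *)
Lemma config_notin bad b c d e : closed_nodes p B bad -> config b c d e \notin bad.
Proof.
case/andP=> /allP closed /allP nonzero.
have [n le_n] : exists n, (b + c + d + e <= n)%N by exists (b + c + d + e)%N.
elim: n b c d e le_n => [|n IHn] b c d e le_n.
  have [-> [-> [-> ->]]] : b = 0%N /\ c = 0%N /\ d = 0%N /\ e = 0%N by lia.
  by apply/negP => /nonzero; rewrite /config /diff /count_u.
have [b' [c' [d' [e' [[? ? ? ?] pred_in]]]]] := config_predecessor b c d e.
have [le_n'|gt_n'] := leqP (b + c + d + e) n; first exact: IHn.
have lt_n : (b' + c' + d' + e' <= n)%N by lia.
apply/negP => /closed /allP in_bad.
have /negP := IHn b' c' d' e' lt_n; apply; apply: in_bad.
by rewrite mem_filter admissible_config.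
Qed.

Lemma mem_sort_pair a b :
  sort_pair a b \in [:: (L, L); (L, S); (L, M); (S, S); (S, M); (M, M)].
Proof. by case: a; case: b. Qed.

(** As 2 * (31 + 14) < 4 * (20 + 6) and 99 < 5 * 20, these limits force |s| <= 3 and |l| <= 4 when l
    + s + m = 0, the box listed in [unbalanced_nodes]. *)
Definition range_check : bool :=
  [&& all (fun a => (-14)%Z <= z_min B a) [:: L; S; M],
      all (fun a => z_max B a <= 31%Z) [:: L; S; M],
      (w_max B - w_min B) * 2%Z <= 99%Z, 6%Z <= t_min B & 6%Z <= t_max B].

Lemma diff_bounds_search b c d e fuel :
  let start := unbalanced_nodes B in
  range_check -> closed_nodes p B (explore p B fuel start start) ->
  (b + c = d + e)%N ->
  [/\ diff p L b c d e < 4, diff p S b c d e < 3 & diff p M b c d e < 3].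
Proof.
move=> start /and5P[/allP z_ge /allP z_le w_le t1_ge t2_ge] closed sum_eq.
have Em : diff p M b c d e = - diff p L b c d e - diff p S b c d e.
  rewrite /diff; have := count_u_sum p_gt1 b; have := count_u_sum p_gt1 c.
  by have := count_u_sum p_gt1 d; have := count_u_sum p_gt1 e; lia.
have [unbal|] := boolP [|| 4%Z <= diff p L b c d e, 3%Z <= diff p S b c d e
                         | 3%Z <= diff p M b c d e]; last first.
  by rewrite !negb_or -!ltNge => /and3P[].
have adm := admissible_config b c d e.
have /negP[] := config_notin b c d e closed; apply: sub_explore.
rewrite mem_filter; apply/andP; split; first exact/andP.
have letter_in a : a \in [:: L; S; M] by case: a.
have {}z_ge a := z_ge a (letter_in a); have {}z_le a := z_le a (letter_in a).
move: adm; rewrite /admissible /config.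
rewrite -!(addrA _ (- z_min B _) (- z_min B _)) -!opprD !sort_pair_sum.
have := z_ge (u p b); have := z_ge (u p c); have := z_ge (u p d); have := z_ge (u p e).
have := z_le (u p b); have := z_le (u p c); have := z_le (u p d); have := z_le (u p e).
move: (z_min B (u p b)) (z_min B (u p c)) (z_min B (u p d)) (z_min B (u p e)).
move: (z_max B (u p b)) (z_max B (u p c)) (z_max B (u p d)) (z_max B (u p e)).
rewrite Em; move: (diff p L b c d e) (diff p S b c d e) => l s.
move=> hb hc hd he lb lc ld le' ? ? ? ? ? ? ? ?.
rewrite /le_scaled; have -> : l + (- l - s) = - s by ring.
have -> : l + s + (- l - s) = 0 by ring.
rewrite !oppr0 !mul0r !orbb !opprK => /and4P[s_ge s_le l_le l_ge].
have s_in : (-3)%Z <= s <= 3%Z.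
  apply/andP; split.
    by case/orP: s_ge => s_ge; nia.
  by case/orP: s_le => s_le; nia.
have l_in : (-4)%Z <= l <= 4%Z by lia.
apply: allpairs_f; last exact: mem_sort_pair.
apply: allpairs_f; last exact: mem_sort_pair.
by apply: (allpairs_f (fun l s => (l, s, - l - s))); rewrite !inE; lia.
Qed.
End Soundness.

(** Outward integer bounds valid for 2/5 <= t <= 9/20; those of [bounds3] hold for 3/10 <= t <=
    7/20. *)
Definition bounds2 : bounds := {|
  t_min := 8%Z; t_max := 9%Z;
  z_min a := match a with L => (-12)%Z | S => 6%Z | M => (-14)%Z end;
  z_max a := match a with L => 22%Z | S => 31%Z | M => 9%Z end;
  w_min := (-9)%Z; w_max := 40%Z |}.

Definition bounds3 : bounds := {|
  t_min := 6%Z; t_max := 7%Z;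
  z_min a := match a with L => (-9)%Z | S => 10%Z | M => (-10)%Z end;
  z_max a := match a with L => 21%Z | S => 28%Z | M => 6%Z end;
  w_min := (-5)%Z; w_max := 39%Z |}.

Lemma closed2 : let start := unbalanced_nodes bounds2 in
  closed_nodes 2 bounds2 (explore 2 bounds2 9 start start).
Proof. by vm_compute. Qed.

Lemma closed3 : let start := unbalanced_nodes bounds3 in
  closed_nodes 3 bounds3 (explore 3 bounds3 4 start start).
Proof. by vm_compute. Qed.

Lemma diff_bounds2 b c d e : (b + c = d + e)%N ->
  [/\ diff 2 L b c d e < 4, diff 2 S b c d e < 3 & diff 2 M b c d e < 3].
Proof.
have [t [t_gt0 t_le t_root]] := perron_root realalg (isT : (1 < 2)%N).
have t_in : 2 / 5 <= t <= 9 / 20.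
  have [[t2 t3] _] := t_powers t_gt0 t_le.
  rewrite !leNgt; apply/andP; split; apply/negP => lt_t.
    by have [[? ?] _] := t_powers t_gt0 (ltW lt_t); lra.
  (* Supplies t^2 > 9t/20, which with t^3 <= t^2 / 2 contradicts the root equation. *)
  have : 0 < t * (t - 9 / 20) by rewrite mulr_gt0 // subr_gt0.
  by lra.
have /andP[_ t_le'] := t_in; have [[t2 t3] [[t4 t5] _]] := t_powers t_gt0 t_le'.
apply: (@diff_bounds_search 2 bounds2 _ t _ _ _ _ _ _ _ _ 9 _ closed2) => //=.
- by lra.
- move=> n; have := @zeta_bounds 2 isT _ t t_gt0 t_le t_root n.
  by case: (u 2 n) => /=; lra.
- by move=> n; have := @zeta_sum_bounds 2 isT _ t t_gt0 t_le t_root n t_le'; lra.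
Qed.

Lemma diff_bounds3 b c d e : (b + c = d + e)%N ->
  [/\ diff 3 L b c d e < 4, diff 3 S b c d e < 3 & diff 3 M b c d e < 3].
Proof.
have [t [t_gt0 t_le t_root]] := perron_root realalg (isT : (1 < 3)%N).
have t_in : 3 / 10 <= t <= 7 / 20.
  have [[t2 t3] _] := t_powers t_gt0 t_le.
  rewrite !leNgt; apply/andP; split; apply/negP => lt_t; last by lra.
  by have [[? ?] _] := t_powers t_gt0 (ltW lt_t); lra.
have /andP[_ t_le'] := t_in; have [[t2 t3] [[t4 t5] _]] := t_powers t_gt0 t_le'.
apply: (@diff_bounds_search 3 bounds3 _ t _ _ _ _ _ _ _ _ 4 _ closed3) => //=.
- by lra.
- move=> n; have := @zeta_bounds 3 isT _ t t_gt0 t_le t_root n.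
  by case: (u 3 n) => /=; lra.
- by move=> n; have := @zeta_sum_bounds 3 isT _ t t_gt0 t_le t_root n ltac:(lra); lra.
Qed.

(** * Balance constants for every p > 1 *)

Lemma diff_bounds p b c d e : (1 < p)%N -> (b + c = d + e)%N ->
  [/\ diff p L b c d e < 4, diff p S b c d e < 3 & diff p M b c d e < 3].
Proof.
case: p => [|[|[|[|p]]]] // _; first exact: diff_bounds2.
  exact: diff_bounds3.
exact: diff_bounds_large.
Qed.

Local Close Scope ring_scope.

Theorem theorem2p1 (p : nat) (hp : 1 < p) :
  (balanced 3 (u p) L /\ balanced 2 (u p) S /\ balanced 2 (u p) M) /\
  (~ balanced 2 (u p) L /\ ~ balanced 1 (u p) S /\ ~ balanced 1 (u p) M).
Proof.
have bounds i j k : [/\ (diff p L (i + k) j i (j + k) < 4)%R,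
    (diff p S (i + k) j i (j + k) < 3)%R & (diff p M (i + k) j i (j + k) < 3)%R].
  by apply: diff_bounds; first exact: hp; lia.
have [nL nS nM] : [/\ ~ balanced 2 (u p) L, ~ balanced 1 (u p) S
                     & ~ balanced 1 (u p) M].
  have [|p_le2] := ltnP 2 p; first exact: not_balanced_gt2.
  have -> : p = 2 by lia.
  exact: not_balanced2.
split; last by split.
do !split; apply: balancedP => i j k; have [] := bounds i j k; rewrite /diff; lia.
Qed.
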